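(* Let $D$ be an infinite division ring, let $n\ge 2$, and let $N$ be a non-central subgroup of $G:=\mathrm{GL}_n(D)$ (i.e. $N$ is not contained in the center of $G$). Then the following conditions are equivalent: (1) $N$ is almost subnormal in $G$; (2) $N$ is subnormal in $G$; (3) $N$ is normal in $G$; (4) $N$ contains $\mathrm{SL}_n(D)$.
   Context: A subgroup $H$ of a group $K$ is almost subnormal in $K$ if there is a chain of subgroups $H=H_r\le H_{r-1}\le\cdots\le H_1=K$ such that for each $1<i\le r$, either $H_i$ is normal in $H_{i-1}$ or $H_i$ has finite index in $H_{i-1}$. $\mathrm{SL}_n(D)$ denotes the subgroup of $\mathrm{GL}_n(D)$ generated by elementary (transvection) matrices. *)

(* Defs.v *)
From HB Require Import structures.
From mathcomp Require Import all_boot all_order all_algebra.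
Set Implicit Arguments. Unset Strict Implicit. Unset Printing Implicit Defensive.
Import GRing.Theory.
Local Open Scope ring_scope.

Section GLDefs.
Variables (R : unitRingType) (n : nat).
Local Notation M := 'M[R]_n.

Definition division_ring_ax : Prop := forall x : R, x != 0 -> x \is a GRing.unit.

Definition infinite_ring : Prop := forall s : seq R, exists x : R, x \notin s.

(* invertibility (two-sided inverse), valid over noncommutative R *)
Definition isGL (A : M) : Prop :=
  exists B : M, A *m B = 1%:M /\ B *m A = 1%:M.

Definition is_subgroup (H : M -> Prop) : Prop :=
  [/\ (forall A, H A -> isGL A),
      H 1%:M,
      (forall A B, H A -> H B -> H (A *m B)) &
      (forall A B, H A -> A *m B = 1%:M -> B *m A = 1%:M -> H B)].

Definition subgroup_of (H K : M -> Prop) : Prop :=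
  is_subgroup H /\ (forall A, H A -> K A).

Definition normal_in (H K : M -> Prop) : Prop :=
  forall k kinv h, K k -> k *m kinv = 1%:M -> kinv *m k = 1%:M ->
    H h -> H (kinv *m h *m k).

Definition finite_index (H K : M -> Prop) : Prop :=
  exists s : seq M, (forall t, t \in s -> K t) /\
    (forall k, K k -> exists2 t, t \in s & exists h, H h /\ k = t *m h).

Definition subnormal (H K : M -> Prop) : Prop :=
  exists (r : nat) (f : nat -> M -> Prop),
    [/\ (forall A, f 0%N A <-> K A),
        (forall A, f r A <-> H A) &
        (forall i, (i < r)%N -> subgroup_of (f i.+1) (f i) /\
                                normal_in (f i.+1) (f i))].

Definition almost_subnormal (H K : M -> Prop) : Prop :=
  exists (r : nat) (f : nat -> M -> Prop),
    [/\ (forall A, f 0%N A <-> K A),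
        (forall A, f r A <-> H A) &
        (forall i, (i < r)%N -> subgroup_of (f i.+1) (f i) /\
             (normal_in (f i.+1) (f i) \/ finite_index (f i.+1) (f i)))].

Definition central_GL (A : M) : Prop :=
  isGL A /\ forall B, isGL B -> A *m B = B *m A.

Definition elementary (A : M) : Prop :=
  exists (i j : 'I_n) (a : R), i != j /\ A = 1%:M + a *: delta_mx i j.

Definition SL (A : M) : Prop :=
  forall S : M -> Prop, is_subgroup S -> (forall E, elementary E -> S E) -> S A.

End GLDefs.

(* Main.v *)
(* Iwasawa's argument. Let H be a non-central subgroup of GL_n(D) normalized by SL_n(D). An element
   of H moves some line of row vectors, and SL_n(D) is doubly transitive on lines, so H carries a
   fixed basis line to every other one. Hence every transvection is congruent modulo H to an element
   of the abelian group V of transvections attached to that line, so SL <= H V and [SL, SL] <= H;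
   as SL is perfect, SL <= H. For H of finite index in K >= SL, apply this to the
   SL-core of H, which contains a nontrivial transvection by the pigeonhole principle, D being
   infinite. So every member of an almost subnormal chain down to N contains SL. Conversely
   GL_n(D) is generated by SL and diagonal matrices with one non-trivial entry, so SL is normal
   in GL_n(D) with abelian quotient. *)
Require Import Defs.
From mathcomp Require Import all_boot all_order all_algebra.
From Stdlib Require Import Classical ClassicalEpsilon.
Set Implicit Arguments. Unset Strict Implicit. Unset Printing Implicit Defensive.
Import GRing.Theory.
Local Open Scope ring_scope.

Local Notation "''e_' k" := (delta_mx (0 : 'I_1) k) : ring_scope.

(** * Two-sided inverses and the subgroups GL and SL *)

Section Inverse.
Variables (R : unitRingType) (n : nat).
Implicit Types A B g h : 'M[R]_n.

(** Entries need not commute, so the inverse is chosen rather than computed by determinants; its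
    value is arbitrary when [A] is not invertible. *)
Definition inv A : 'M[R]_n :=
  epsilon (inhabits 0) (fun B => A *m B = 1%:M /\ B *m A = 1%:M).

Lemma mulmx_inv A : isGL A -> A *m inv A = 1%:M.
Proof. by move=> GA; case: (epsilon_spec (inhabits 0) _ GA). Qed.

Lemma mul_invmx A : isGL A -> inv A *m A = 1%:M.
Proof. by move=> GA; case: (epsilon_spec (inhabits 0) _ GA). Qed.

Lemma mulmxK m A (B : 'M_(m, n)) : isGL A -> B *m A *m inv A = B.
Proof. by move=> GA; rewrite -mulmxA mulmx_inv // mulmx1. Qed.

Lemma mulmxVK m A (B : 'M_(m, n)) : isGL A -> B *m inv A *m A = B.
Proof. by move=> GA; rewrite -mulmxA mul_invmx // mulmx1. Qed.

Lemma isGL_inv A : isGL A -> isGL (inv A).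
Proof. by move=> GA; exists A; rewrite mulmx_inv ?mul_invmx. Qed.

Lemma inv_uniq A B : A *m B = 1%:M -> B *m A = 1%:M -> inv A = B.
Proof.
move=> AB BA; have GA : isGL A by exists B.
by rewrite -[inv A]mul1mx -BA mulmxK.
Qed.

Lemma invK A : isGL A -> inv (inv A) = A.
Proof. by move=> GA; apply: inv_uniq; rewrite ?mulmx_inv ?mul_invmx. Qed.

Lemma isGLM A B : isGL A -> isGL B -> isGL (A *m B).
Proof.
move=> GA GB; exists (inv B *m inv A).
by rewrite !mulmxA !mulmxK ?mulmxVK ?mulmx_inv ?mul_invmx.
Qed.

Lemma invM A B : isGL A -> isGL B -> inv (A *m B) = inv B *m inv A.
Proof.
move=> GA GB; apply: inv_uniq.
  by rewrite mulmxA mulmxK ?mulmx_inv.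
by rewrite mulmxA mulmxVK ?mul_invmx.
Qed.

Lemma isGL1 : isGL (1%:M : 'M[R]_n).
Proof. by exists 1%:M; rewrite mulmx1. Qed.

Lemma subgroupGL : is_subgroup (@isGL R n).
Proof.
split=> //; first exact: isGL1; first exact: isGLM.
by move=> A B _ AB BA; exists A.
Qed.

Lemma subgroup_inv (H : 'M[R]_n -> Prop) A :
  is_subgroup H -> H A -> H (inv A).
Proof.
case=> HG _ _ HV HA; have GA := HG _ HA.
by apply: (HV A); rewrite ?mulmx_inv ?mul_invmx.
Qed.

(** [SL] is an intersection of subgroups, so applying a membership proof to a subgroup is induction
    on generators. Here [1 - a E_ij] inverts [1 + a E_ij] because [(a E_ij)^2 = 0]. *)
Lemma isGL_SL A : SL A -> isGL A.
Proof.
apply; first exact: subgroupGL.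
move=> _ [i [j [a [ij ->]]]]; exists (1%:M - a *: delta_mx i j).
have sq0 : a *: delta_mx i j *m (a *: delta_mx i j) = 0 :> 'M[R]_n.
  apply/matrixP=> k l; rewrite !mxE big1 // => p _; rewrite !mxE.
  by case: (p =P i) => [->|]; rewrite ?(negPf ij) ?andbF ?(mulr0, mul0r).
rewrite mulmxDl mulmxBl !mul1mx mulmxBr mulmxDr !mulmx1 sq0 subr0 addr0.
by rewrite subrK addrK.
Qed.

Lemma subgroupSL : is_subgroup (@SL R n).
Proof.
split; first exact: isGL_SL.
- by move=> S [].
- by move=> A B SA SB S sgS eS; case: (sgS) => _ _ SM _; apply: SM; [apply: SA|apply: SB].
- move=> A B SA AB BA S sgS eS; case: (sgS) => _ _ _ SV.
  by apply: SV AB BA; apply: SA.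
Qed.

End Inverse.

(** * Transvections, diagonal matrices and Weyl elements *)

Section Transvections.
Variables (R : unitRingType) (n : nat).
Implicit Types (i j k : 'I_n) (a b : R).

(* For i = j this is the diagonal matrix with entry 1 + a in position i. *)
Definition xmx i j a : 'M[R]_n := 1%:M + a *: delta_mx i j.

Definition transv (c : 'cV[R]_n) (phi : 'rV[R]_n) : 'M[R]_n := 1%:M + c *m phi.

(** Matrices act on rows from the right and scalars from the left, so identities checked on basis
    rows never require scalars to commute. *)
Lemma eq_mx_rows (A B : 'M[R]_n) :
  (forall k, 'e_k *m A = 'e_k *m B) -> A = B.
Proof. by move=> AB; apply/row_matrixP=> k; rewrite !rowE. Qed.

Lemma xmx_transv i j a : xmx i j a = transv (a *: delta_mx i 0) 'e_j.
Proof. by rewrite /transv -scalemxAl mul_delta_mx. Qed.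

Lemma xmx_transvl i j a : xmx i j a = transv (delta_mx i 0) (a *: 'e_j).
Proof.
congr (_ + _); apply/matrixP=> k l; rewrite !mxE big_ord1 !mxE /= andbT.
by case: (k == i); rewrite ?mul1r ?mul0r ?mulr0.
Qed.

Lemma mul_transv m (u : 'M_(m, n)) c phi : u *m transv c phi = u + u *m c *m phi.
Proof. by rewrite mulmxDr mulmx1 mulmxA. Qed.

Lemma transvD c c' (phi phi' : 'rV[R]_n) : phi *m c' = 0 ->
  transv c phi *m transv c' phi' = 1%:M + c *m phi + c' *m phi'.
Proof.
by move=> pc; rewrite mul_transv {2}/transv mulmxDl mul1mx -(mulmxA c) pc mulmx0 addr0.
Qed.

Lemma mul_col (u : 'rV[R]_n) i (phi : 'rV[R]_n) :
  u *m delta_mx i 0 *m phi = u 0 i *: phi.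
Proof.
rewrite -colE; apply/matrixP=> k l; rewrite !mxE big_ord1 !mxE.
by rewrite !ord1.
Qed.

Lemma mul_xmx (u : 'rV[R]_n) i j a : u *m xmx i j a = u + (u 0 i * a) *: 'e_j.
Proof. by rewrite xmx_transvl mul_transv mul_col scalerA. Qed.

Lemma rowB_xmx k i j a :
  'e_k *m xmx i j a = if k == i then 'e_k + a *: 'e_j else 'e_k.
Proof.
by rewrite mul_xmx !mxE /= eq_sym; case: ifP; rewrite ?mul1r ?mul0r ?scale0r ?addr0.
Qed.

Lemma SL_xmx i j a : i != j -> SL (xmx i j a).
Proof. by move=> ij S _; apply; exists i, j, a. Qed.

(** Expanding [phi] in the basis gives a product of matrices [xmx i j (phi 0 j)] with [j != i]. The
    invariant [P] keeps [psi 0 i = 0], which kills the cross term in [transvD]. *)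
Lemma SL_transv_row i (phi : 'rV[R]_n) :
  phi 0 i = 0 -> SL (transv (delta_mx i 0) phi).
Proof.
have [_ SL1 SLM _] := subgroupSL R n.
have col0 (psi : 'rV[R]_n) : psi 0 i = 0 -> psi *m delta_mx i (0 : 'I_1) = 0.
  by move=> psi0; rewrite -colE; apply/matrixP=> k l; rewrite !mxE ord1 psi0.
pose P (psi : 'rV[R]_n) := psi 0 i = 0 /\ SL (transv (delta_mx i 0) psi).
move=> phi0; suff [] : P phi by [].
rewrite [phi]row_sum_delta; apply: big_ind.
- by split; rewrite ?mxE // /transv mulmx0 addr0.
- move=> f g [f0 Sf] [g0 Sg]; split; first by rewrite mxE f0 g0 addr0.
  suff -> : transv (delta_mx i 0) (f + g)
      = transv (delta_mx i 0) f *m transv (delta_mx i 0) g by apply: SLM.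
  by rewrite transvD ?col0 // /transv mulmxDr addrA.
- move=> j _; have [<-|ij] := eqVneq i j.
    by rewrite phi0 scale0r; split; rewrite ?mxE // /transv mulmx0 addr0.
  split; first by rewrite !mxE (negPf ij) mulr0.
  by rewrite -xmx_transvl; apply: SL_xmx.
Qed.

(** The column counterpart; for fixed [k] these matrices form the abelian group V of Iwasawa's
    argument. *)
Lemma SL_transv_col k (c : 'cV[R]_n) : c k 0 = 0 -> SL (transv c 'e_k).
Proof.
have [_ SL1 SLM _] := subgroupSL R n.
pose P (c : 'cV[R]_n) := c k 0 = 0 /\ SL (transv c 'e_k).
move=> c0; suff [] : P c by [].
rewrite [c]matrix_sum_delta; under eq_bigr do rewrite big_ord1.
apply: big_ind.
- by split; rewrite ?mxE // /transv mul0mx addr0.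
- move=> f g [f0 Sf] [g0 Sg]; split; first by rewrite mxE f0 g0 addr0.
  suff -> : transv (f + g) 'e_k = transv f 'e_k *m transv g 'e_k by apply: SLM.
  rewrite transvD; last by rewrite -rowE; apply/matrixP=> a b; rewrite !mxE !ord1 g0.
  by rewrite /transv mulmxDl addrA.
- move=> j _; have [<-|kj] := eqVneq k j.
    by rewrite c0 scale0r; split; rewrite ?mxE // /transv mul0mx addr0.
  split; first by rewrite !mxE (negPf kj) mulr0.
  by rewrite -xmx_transv; apply: SL_xmx; rewrite eq_sym.
Qed.

Lemma xmxD i j a b : i != j -> xmx i j a *m xmx i j b = xmx i j (a + b).
Proof.
move=> ij; apply: eq_mx_rows => k.
rewrite mulmxA !rowB_xmx; case: eqP => [->|/eqP/negPf ki]; last by rewrite rowB_xmx ki.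
by rewrite mulmxDl -scalemxAl !rowB_xmx eqxx eq_sym (negPf ij) scalerDl -addrA [b *: _ + _]addrC.
Qed.

Lemma inv_xmx i j a : i != j -> inv (xmx i j a) = xmx i j (- a).
Proof.
by move=> ij; apply: inv_uniq; rewrite xmxD // ?subrr ?addNr /xmx scale0r addr0.
Qed.

(** The diagonal matrix with [a] in position [i] and 1 elsewhere. *)
Definition dmx i a : 'M[R]_n := xmx i i (a - 1).

Lemma rowB_dmx k i a : 'e_k *m dmx i a = if k == i then a *: 'e_k else 'e_k.
Proof.
rewrite rowB_xmx; case: eqP => // ->.
by rewrite -{1}['e_i]scale1r -scalerDl addrC subrK.
Qed.

Lemma dmxM i a b : dmx i a *m dmx i b = dmx i (a * b).
Proof.
apply: eq_mx_rows => k; rewrite mulmxA !rowB_dmx; case: ifP => ki.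
  by rewrite -scalemxAl rowB_dmx ki scalerA.
by rewrite rowB_dmx ki.
Qed.

Lemma dmx1 i : dmx i 1 = 1%:M.
Proof. by rewrite /dmx /xmx subrr scale0r addr0. Qed.

Lemma inv_dmx i a : a \is a GRing.unit -> inv (dmx i a) = dmx i a^-1.
Proof. by move=> ua; apply: inv_uniq; rewrite dmxM ?mulrV ?mulVr ?dmx1. Qed.

Lemma isGL_dmx i a : a \is a GRing.unit -> isGL (dmx i a).
Proof. by move=> ua; exists (dmx i a^-1); rewrite !dmxM ?mulrV ?mulVr ?dmx1. Qed.

Lemma dmxC i j a b : i != j -> dmx i a *m dmx j b = dmx j b *m dmx i a.
Proof.
move=> ij; apply: eq_mx_rows => k; rewrite !mulmxA !rowB_dmx.
have [->|ki] := eqVneq k i.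
  by rewrite (negPf ij) -scalemxAl !rowB_dmx (negPf ij) eqxx.
by case: ifP => kj; rewrite -?scalemxAl !rowB_dmx (negPf ki) ?kj.
Qed.

(** Conjugation by a diagonal matrix multiplies entry [(j, k)] on the left by the j-th diagonal
    entry and on the right by the inverse of the k-th. *)
Lemma dmx_xmx i j k a b : a \is a GRing.unit -> j != k ->
  dmx i a *m xmx j k b =
  xmx j k ((if i == j then a else 1) * b * (if i == k then a^-1 else 1)) *m dmx i a.
Proof.
move=> ua jk; apply: eq_mx_rows => l; rewrite !mulmxA rowB_dmx rowB_xmx.
have kl : k == l -> (l == j) = false.
  by move/eqP <-; rewrite eq_sym (negPf jk).
have [->|li] := eqVneq l i.
  rewrite -scalemxAl rowB_xmx; case: eqP => [ij|/eqP ij].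
    subst j; rewrite (negPf jk) mulr1 mulmxDl -scalemxAl.
    by rewrite !rowB_dmx eqxx eq_sym (negPf jk) scalerDr scalerA.
  by rewrite rowB_dmx eqxx.
rewrite rowB_xmx; case: eqP => [lj|/eqP lj]; last by rewrite rowB_dmx (negPf li).
subst l; rewrite mulmxDl -scalemxAl !rowB_dmx (negPf li) [i == j]eq_sym (negPf li) mul1r.
rewrite [k == i]eq_sym; case: (eqVneq i k) => [<-|ik]; last by rewrite mulr1.
by rewrite scalerA mulrVK.
Qed.

(* The Weyl element 'e_i -> 'e_j, 'e_j -> - 'e_i. *)
Definition wmx i j : 'M[R]_n := xmx i j 1 *m xmx j i (-1) *m xmx i j 1.

Lemma SL_wmx i j : i != j -> SL (wmx i j).
Proof.
have [_ _ SLM _] := subgroupSL R n.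
by move=> ij; apply: (SLM); first apply: (SLM); apply: SL_xmx => //; rewrite eq_sym.
Qed.

(** The Weyl element carries a diagonal entry from place [i] to place [j], so that [dmx i a] and
    [dmx j a] are conjugate under SL. *)
Lemma dmx_wmx i j a : i != j -> dmx i a *m wmx i j = wmx i j *m dmx j a.
Proof.
move=> ij; have ji : (j == i) = false by rewrite eq_sym (negPf ij).
have wi : 'e_i *m wmx i j = 'e_j.
  rewrite !mulmxA rowB_xmx eqxx scale1r mulmxDl !rowB_xmx (negPf ij) eqxx.
  by rewrite scaleN1r addrC subrK rowB_xmx ji.
have wj : 'e_j *m wmx i j = - 'e_i.
  rewrite !mulmxA rowB_xmx ji rowB_xmx eqxx scaleN1r mulmxBl !rowB_xmx eqxx ji.
  by rewrite scale1r opprD addrC subrK.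
apply: eq_mx_rows => k; rewrite mulmxA [RHS]mulmxA rowB_dmx.
have [->|ki] := eqVneq k i; first by rewrite -scalemxAl wi rowB_dmx eqxx.
have [->|kj] := eqVneq k j.
  by rewrite wj mulNmx rowB_dmx (negPf ij).
have wk : 'e_k *m wmx i j = 'e_k.
  by rewrite !mulmxA rowB_xmx (negPf ki) rowB_xmx (negPf kj) rowB_xmx (negPf ki).
by rewrite wk rowB_dmx (negPf kj).
Qed.

End Transvections.

(** The set is [g H g^-1]. It serves for induction on [SL] under conjugation and for intersecting
    conjugates. *)
Lemma subgroup_conj (R : unitRingType) n (H : 'M[R]_n -> Prop) g :
  is_subgroup H -> isGL g -> is_subgroup (fun A => H (inv g *m A *m g)).
Proof.
move=> sgH Gg; case: (sgH) => HG H1 HM _.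
have GLc A : H (inv g *m A *m g) -> isGL A.
  move=> /HG GA.
  have -> : A = g *m (inv g *m A *m g) *m inv g by rewrite !mulmxA mulmxK ?mulmx_inv ?mul1mx.
  by apply: isGLM (isGL_inv Gg); apply: isGLM.
split=> //; first by rewrite mulmx1 mul_invmx.
- move=> A B HA HB.
  have -> : inv g *m (A *m B) *m g = (inv g *m A *m g) *m (inv g *m B *m g).
    by rewrite !mulmxA mulmxK.
  exact: HM.
- move=> A B HA AB BA; rewrite -(inv_uniq AB BA).
  have GA := GLc A HA; have := subgroup_inv sgH HA.
  by rewrite !invM ?invK ?mulmxA //; do ?apply: isGLM; do ?apply: isGL_inv.
Qed.

(** * Row reduction: GL is generated by SL and the matrices [dmx i d] *)

Section DivisionRing.
Variables (D : unitRingType) (n : nat).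
Hypothesis divD : division_ring_ax D.
Hypothesis n_gt1 : (2 <= n)%N.
Implicit Types (i j k : 'I_n) (a b d : D) (A B g h : 'M[D]_n).

Lemma ex_neq i : exists j, i != j.
Proof.
case: (eqVneq i (Ordinal n_gt1)) => [->|]; last by exists (Ordinal n_gt1).
by exists (Ordinal (ltnW n_gt1)).
Qed.

(** If [w 0 i] is nonzero, one transvection clears the other entries; otherwise column [j] is first
    added to column [i]. Fixing the remaining basis rows protects what was reduced earlier. *)
Lemma SL_row_to_line (w : 'rV[D]_n) i j : w 0 j != 0 ->
  exists g l, [/\ SL g, l != 0, w *m g = l *: 'e_i &
                  forall k, k != i -> k != j -> 'e_k *m g = 'e_k].
Proof.
have [_ _ SLM _] := subgroupSL D n.
have main (u : 'rV[D]_n) : u 0 i != 0 ->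
  exists g, [/\ SL g, u *m g = u 0 i *: 'e_i & forall k, k != i -> 'e_k *m g = 'e_k].
  move=> ui; exists (transv (delta_mx i 0) ('e_i - (u 0 i)^-1 *: u)); split.
  - by apply: SL_transv_row; rewrite !mxE !eqxx /= mulVr ?subrr //; apply: divD.
  - by rewrite mul_transv mul_col scalerBr scalerA mulrV ?scale1r; [rewrite addrC subrK|apply: divD].
  - move=> k ki; rewrite mul_transv mul_col mxE eqxx eq_sym (negPf ki).
    by rewrite scale0r addr0.
move=> wj; have [wi|wi] := eqVneq (w 0 i) 0; last first.
  have [g [Sg gw gk]] := main w wi.
  by exists g, (w 0 i); split=> // k ki _; apply: gk.
have ij : j != i by apply: contraNneq wj => ->; rewrite wi.
have wi' : (w *m xmx j i 1) 0 i = w 0 j.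
  by rewrite mul_xmx !mxE !eqxx wi add0r !mulr1.
have [|g [Sg gw gk]] := main (w *m xmx j i 1); first by rewrite wi'.
exists (xmx j i 1 *m g), (w 0 j); split=> //.
- by apply: SLM => //; apply: SL_xmx.
- by rewrite mulmxA gw wi'.
- by move=> k ki kj; rewrite mulmxA rowB_xmx (negPf kj) gk.
Qed.

(** Gaussian elimination: right multiplication by elements of [S] turns the first [m] rows of [A]
    into basis rows, by induction on [m]. *)
Lemma isGL_generated (S : 'M[D]_n -> Prop) :
  is_subgroup S -> (forall A, SL A -> S A) ->
  (forall i d, d != 0 -> S (dmx i d)) -> forall A, isGL A -> S A.
Proof.
move=> sgS SSL Sdmx A GA; case: (sgS) => SG S1 SM _.
suff [g [Sg gA]] : exists g, S g /\ forall i, (i < n)%N -> 'e_i *m (A *m g) = 'e_i.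
  have Ag : A *m g = 1%:M by apply: eq_mx_rows => k; rewrite gA // mulmx1.
  have -> : A = inv g; last exact: subgroup_inv.
  by rewrite -[inv g]mul1mx -Ag mulmxK //; apply: SG.
suff: forall m, (m <= n)%N ->
    exists g, S g /\ forall i, (i < m)%N -> 'e_i *m (A *m g) = 'e_i by apply.
elim=> [|m IHm] mn; first by exists 1%:M.
have [g [Sg gA]] := IHm (ltnW mn); pose i := Ordinal mn.
have GAg : isGL (A *m g) by apply: isGLM => //; apply: SG.
set w := 'e_i *m (A *m g).
(* Otherwise [w] is a combination of earlier basis rows, hence fixed by [A *m g]; cancelling
   [A *m g] gives [w = 'e_i], whose entry at [i] is 1. *)
have [j /andP[mj wj]] : exists j : 'I_n, (m <= j)%N && (w 0 j != 0).
  apply/existsP; apply: contraT; rewrite negb_exists => /forallP w0.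
  have ww : w *m (A *m g) = w.
    rewrite mulmx_sum_row [RHS]row_sum_delta; apply: eq_bigr => j _.
    have [/gA jm|mj] := ltnP j m; first by rewrite rowE jm.
    by have := w0 j; rewrite mj /= negbK => /eqP ->; rewrite !scale0r.
  have wi : w = 'e_i.
    by rewrite -[LHS](mulmxK _ GAg) ww /w mulmxK.
  by have := w0 i; rewrite wi leqnn mxE !eqxx oner_eq0.
have [e [l [Se l0 we ek]]] := SL_row_to_line i wj.
have ul : l \is a GRing.unit by apply: divD.
exists (g *m (e *m dmx i l^-1)); split.
  by apply: (SM) => //; apply: SM; [apply: SSL|apply: Sdmx; rewrite invr_eq0].
move=> k; rewrite ltnS leq_eqVlt => /orP[/eqP km|km].
  have -> : k = i by apply: val_inj.
  by rewrite (mulmxA A) (mulmxA 'e_i) -/w mulmxA we -scalemxAl rowB_dmx eqxx scalerA mulrV ?scale1r.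
have ki : k != i by apply: contraTneq km => ->; rewrite ltnn.
rewrite (mulmxA A) (mulmxA 'e_k) gA // mulmxA ek //; last first.
  by apply: contraTneq km => ->; rewrite -leqNgt.
by rewrite rowB_dmx (negPf ki).
Qed.

(** * SL is normal in GL, with abelian quotient *)

Lemma SL_conj_dmx i d A : d != 0 -> SL A -> SL (inv (dmx i d) *m A *m dmx i d).
Proof.
move=> /divD ud SLA; have Gd := isGL_dmx i ud.
apply: (SLA (fun A => SL (inv (dmx i d) *m A *m dmx i d))); first exact: subgroup_conj (subgroupSL D n) Gd.
move=> _ [j [k [a [jk ->]]]]; rewrite -/(xmx j k a) inv_dmx //.
rewrite dmx_xmx ?unitrV // -mulmxA dmxM mulVr // dmx1 mulmx1.
exact: SL_xmx.
Qed.

Lemma SL_normal g A : isGL g -> SL A -> SL (inv g *m A *m g).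
Proof.
move: g A.
have [_ SL1 SLM _] := subgroupSL D n.
(* Both directions of conjugation are required so that [S] is visibly closed under inverses. *)
pose S g := isGL g /\ forall A, SL A -> SL (inv g *m A *m g) /\ SL (g *m A *m inv g).
suff SP g : isGL g -> S g by move=> g A /SP [_ Sg] /Sg [].
move: g; apply: (@isGL_generated S).
- split; first by move=> ? [].
  + split=> [|A SA]; first exact: isGL1.
    by rewrite (inv_uniq (mulmx1 _) (mulmx1 _)) mulmx1 mul1mx.
  + move=> g h [Gg Sg] [Gh Sh]; split=> [|A SA]; first exact: isGLM.
    rewrite invM // !mulmxA; split.
      by have := (Sh _ (Sg _ SA).1).1; rewrite !mulmxA.
    by have := (Sg _ (Sh _ SA).2).2; rewrite !mulmxA.
  + move=> g h [Gg Sg] gh hg; rewrite -(inv_uniq gh hg).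
    split=> [|A /Sg]; first exact: isGL_inv.
    by rewrite invK // => -[].
- move=> g SLg; have SLg' := subgroup_inv (subgroupSL D n) SLg.
  by split=> [|A SA]; [exact: isGL_SL | split; apply: (SLM) => //; apply: SLM].
- move=> i d d0; have ud := divD d0; split=> [|A SA]; first exact: isGL_dmx.
  split; first exact: SL_conj_dmx.
  have := @SL_conj_dmx i d^-1 A; rewrite invr_eq0 inv_dmx ?unitrV // inv_dmx // invrK.
  exact.
Qed.

Lemma SL_normalV g A : isGL g -> SL A -> SL (g *m A *m inv g).
Proof. by move=> Gg SA; rewrite -{1}(invK Gg); apply: SL_normal => //; apply: isGL_inv. Qed.

(** For invertible matrices: the commutator [A B A^-1 B^-1] lies in [SL], written without
    inverses. *)
Definition commSL A B := exists2 e, SL e & A *m B = e *m B *m A.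

Lemma commSL_sym A B : commSL A B -> commSL B A.
Proof.
case=> e SLe AB; exists (inv e); first exact: subgroup_inv (subgroupSL D n) SLe.
by rewrite -(mulmxA (inv e)) AB -(mulmxA e) (mulmxA (inv e)) mul_invmx ?mul1mx //; apply: isGL_SL.
Qed.

(** This is the preimage of the centralizer of [B] modulo the normal subgroup [SL]. *)
Lemma subgroup_commSL B : isGL B -> is_subgroup (fun A => isGL A /\ commSL A B).
Proof.
have [_ SL1 SLM _] := subgroupSL D n.
move=> GB; split; first by move=> ? [].
- by split; [exact: isGL1 | exists 1%:M; rewrite ?mulmx1 ?mul1mx].
- move=> A A' [GA [e SLe AB]] [GA' [e' SLe' AB']]; split; first exact: isGLM.
  exists (A *m e' *m inv A *m e); first by apply: SLM => //; apply: SL_normalV.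
  rewrite -(mulmxA A) AB' !mulmxA -(mulmxA _ e) -(mulmxA _ (e *m B)) -AB.
  by rewrite !mulmxA mulmxVK.
- move=> A A' [GA [e SLe AB]] AA' A'A; rewrite -(inv_uniq AA' A'A).
  split; first exact: isGL_inv.
  have SLe' := subgroup_inv (subgroupSL D n) SLe.
  exists (inv A *m inv e *m A); first exact: SL_normal.
  rewrite -!mulmxA; congr (_ *m _).
  have Ge := isGL_SL SLe.
  rewrite -[B in LHS](mulmxK _ GA) -[B *m A]mul1mx -(mul_invmx Ge).
  by rewrite -(mulmxA _ e) (mulmxA e) -AB !mulmxA.
Qed.

(** Generation is used twice, first on [A] and then on [B], which leaves two diagonal generators. In
    different positions they commute; in the same position one of them is moved away modulo [SL]. *)
Lemma commSL_GL A B : isGL A -> isGL B -> commSL A B.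
Proof.
have [_ _ SLM _] := subgroupSL D n.
have commSLl g h : SL g -> isGL h -> commSL g h.
  move=> SLg Gh; exists (g *m (h *m inv g *m inv h)).
    by apply: SLM => //; apply: SL_normalV => //; apply: subgroup_inv (subgroupSL D n) SLg.
  by rewrite !mulmxA !mulmxVK //; apply: isGL_SL.
have comm_dmx i d j d' : d != 0 -> d' != 0 -> i != j -> commSL (dmx j d') (dmx i d).
  move=> d0 d'0 ij; exists 1%:M; last by rewrite mul1mx dmxC // eq_sym.
  by have [] := subgroupSL D n.
have GLd i d : d != 0 -> isGL (dmx i d : 'M[D]_n) by move=> d0; apply/isGL_dmx/divD.
move=> GA GB; move: A GA; suff H : forall A, isGL A -> isGL A /\ commSL A B by move=> A /H [].
apply: (isGL_generated (S := fun A => isGL A /\ commSL A B)); first exact: subgroup_commSL.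
  by move=> g Sg; split; [exact: isGL_SL | exact: commSLl].
move=> i d d0; split; first exact: GLd.
apply: commSL_sym; suff H : forall C, isGL C -> isGL C /\ commSL C (dmx i d) by case: (H _ GB).
have sg := subgroup_commSL (GLd i _ d0).
apply: (isGL_generated (S := fun A => isGL A /\ commSL A (dmx i d))) => //.
  by move=> g Sg; split; [exact: isGL_SL | apply: commSLl => //; exact: GLd].
move=> j d' d'0; have [->|ij] := eqVneq j i; last first.
  by split; [exact: GLd | apply: comm_dmx => //; rewrite eq_sym].
(* dmx i d' is conjugate under SL to dmx k d' with k != i, which commutes with dmx i d. *)
have [k ik] := ex_neq i; have SLw := @SL_wmx D n i k ik; have Gw := isGL_SL SLw.
have -> : dmx i d' = wmx D i k *m dmx k d' *m inv (wmx D i k) by rewrite -dmx_wmx // mulmxK.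
have Cw : isGL (wmx D i k) /\ commSL (wmx D i k) (dmx i d).
  by split=> //; apply: commSLl => //; exact: GLd.
case: (sg) => _ _ sgM _; apply: (sgM); last exact: subgroup_inv sg Cw.
by apply: (sgM) => //; split; [exact: GLd|apply: comm_dmx].
Qed.

(** Since GL/SL is abelian, [k^-1 h k = e h] for some [e] in [SL]. *)
Lemma normal_of_SL_sub (N : 'M[D]_n -> Prop) :
  subgroup_of N (@isGL D n) -> (forall A, SL A -> N A) -> normal_in N (@isGL D n).
Proof.
move=> [[_ _ NM _] NG] SLN k k' h Gk kk' k'k Nh.
have Gk' : isGL k' by exists k.
have [e SLe ->] := commSL_GL Gk' (NG _ Nh).
by rewrite -mulmxA k'k mulmx1; apply: NM => //; apply: SLN.
Qed.

(** * Iwasawa's argument for subgroups normalized by SL *)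

Lemma noncentral_moves_line h : isGL h -> ~ central_GL h ->
  exists2 v : 'rV[D]_n, v != 0 & forall l, v *m h <> l *: v.
Proof.
move=> Gh nch; apply: NNPP => H; apply: nch; split=> // B _.
(* If every row is an eigenvector, the rows ['e_k] make [h] diagonal, and the rows
   [a *: 'e_k + 'e_l] give [a * h k k = h l l * a]. Taking [a = 1] equates the diagonal entries, so
   [h] is a central scalar. *)
have eigen (v : 'rV_n) : exists l, v *m h = l *: v.
  have [->|v0] := eqVneq v 0; first by exists 0; rewrite mul0mx scaler0.
  apply: NNPP => nl; apply: H; exists v => // l vl; apply: nl; by exists l.
have h0 k l : l != k -> h k l = 0.
  move=> lk; have [m /rowP /(_ l)] := eigen 'e_k.
  by rewrite -rowE !mxE (negPf lk) andbF mulr0.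
have hC a k l : k != l -> a * h k k = h l l * a.
  move=> kl; have [m /rowP E] := eigen (a *: 'e_k + 'e_l).
  have := E l; have := E k; rewrite mulmxDl -scalemxAl -!rowE !mxE !eqxx.
  rewrite (negPf kl) [l == k]eq_sym (negPf kl) /= (h0 k l) 1?eq_sym // (h0 l k) //.
  by rewrite !mulr0 !mulr1 !addr0 !add0r mulr1 => -> ->.
have hC' a k l : h k k * a = a * h l l.
  have [kl|kl] := eqVneq k l; last by rewrite (hC a l k) // eq_sym.
  rewrite -{}kl; have [j kj] := ex_neq k.
  by rewrite [RHS](hC a k j) // -[h k k]mul1r (hC 1 k j) // mulr1.
apply/matrixP=> k l; rewrite !mxE [LHS](bigD1 k) //= [RHS](bigD1 l) //= (hC' _ k l).
by congr (_ + _); rewrite !big1 // => j jkl; rewrite h0 ?mulr0 ?mul0r // eq_sym.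
Qed.

Definition SL_invariant (H : 'M[D]_n -> Prop) :=
  forall g h, SL g -> H h -> H (inv g *m h *m g).

Section Invariant.
Variable H : 'M[D]_n -> Prop.
Hypotheses (sgH : is_subgroup H) (invH : SL_invariant H).

Lemma SL_invariantV g h : SL g -> H h -> H (g *m h *m inv g).
Proof.
move=> SLg Hh; rewrite -{1}(invK (isGL_SL SLg)); apply: invH => //.
exact: subgroup_inv (subgroupSL D n) SLg.
Qed.

(** Conjugate [h] by [g1 *m g2]: [g1] sends a moved line to that of ['e_i], then [g2] fixes ['e_i]
    and sends the image line to that of ['e_k]. *)
Lemma moves_basis_lines h i k : H h -> ~ central_GL h -> i != k ->
  exists h' l, [/\ H h', l != 0 & 'e_i *m h' = l *: 'e_k].
Proof.
have [HG _ _ _] := sgH; have [_ _ SLM _] := subgroupSL D n.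
move=> Hh nch ik; have [v v0 vh] := noncentral_moves_line (HG _ Hh) nch.
have [j vj] : exists j, v 0 j != 0.
  apply/existsP; apply: contra_neqT v0; rewrite negb_exists => /forallP v0.
  by apply/rowP=> j; have := v0 j; rewrite negbK mxE => /eqP.
have [g1 [l1 [Sg1 l10 vg1 _]]] := SL_row_to_line i vj.
have ul1 := divD l10; have Gg1 := isGL_SL Sg1.
have vE : v = l1 *: ('e_i *m inv g1) by rewrite scalemxAl -vg1 mulmxK.
(* The image is off the line of ['e_i] because [h] moves the line of [v]; a pivot [j' != i] lets
   [g2] fix ['e_i]. *)
have [j' /andP[j'i wj']] : exists j', (j' != i) && ((v *m h *m g1) 0 j' != 0).
  apply/existsP; apply: contraT; rewrite negb_exists => /forallP w0; exfalso.
  apply: (vh ((v *m h *m g1) 0 i * l1^-1)).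
  rewrite -[LHS](mulmxK _ Gg1) {3}vE scalerA mulrVK // scalemxAl; congr (_ *m _).
  rewrite [LHS]row_sum_delta (bigD1 i) //= big1 ?addr0 // => j' j'i.
  by have := w0 j'; rewrite j'i /= negbK => /eqP ->; rewrite scale0r.
have [g2 [l2 [Sg2 l20 wg2 g2e]]] := SL_row_to_line k wj'.
have Gg2 := isGL_SL Sg2.
have e2 : 'e_i *m g2 = 'e_i by apply: g2e; rewrite // eq_sym.
have e2V : 'e_i *m inv g2 = 'e_i by rewrite -{1}e2 mulmxK.
exists (inv (g1 *m g2) *m h *m (g1 *m g2)), (l1^-1 * l2); split.
- by apply: invH => //; apply: SLM.
- by have := unitrMl l1^-1 (divD l20); rewrite unitrV ul1; apply: contraTneq => ->; rewrite unitr0.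
- have -> : 'e_i = l1^-1 *: (v *m g1 *m g2) by rewrite vg1 -scalemxAl e2 scalerA mulVr ?scale1r.
  by rewrite -!scalemxAl invM // !mulmxA !mulmxK // wg2 scalerA.
Qed.

(* The matrices congruent modulo H to some 1 + c 'e_i with c_i = 0, whose inverse is 1 - c 'e_i. *)
Definition mod_transv i A :=
  isGL A /\ exists2 c : 'cV[D]_n, c i 0 = 0 & H (A *m transv (- c) 'e_i).

Lemma rowB_col0 i (c : 'cV[D]_n) : c i 0 = 0 -> 'e_i *m c = 0.
Proof. by move=> c0; rewrite -rowE; apply/matrixP=> a b; rewrite !mxE !ord1 c0. Qed.

Lemma transvDl i (c c' : 'cV[D]_n) : c' i 0 = 0 ->
  transv c 'e_i *m transv c' 'e_i = transv (c + c') 'e_i :> 'M[D]_n.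
Proof. by move=> c0; rewrite transvD ?rowB_col0 // /transv mulmxDl addrA. Qed.

Lemma inv_transv i (c : 'cV[D]_n) : c i 0 = 0 -> inv (transv c 'e_i) = transv (- c) 'e_i.
Proof.
move=> c0; have nc0 : (- c) i 0 = 0 by rewrite mxE c0 oppr0.
by apply: inv_uniq; rewrite transvDl // ?subrr ?addNr /transv mul0mx addr0.
Qed.

Lemma mod_transvP i A : isGL A -> mod_transv i A <->
  exists2 c : 'cV[D]_n, c i 0 = 0 & H (A *m inv (transv c 'e_i)).
Proof.
by move=> GA; split=> [[_ [c c0 Hc]]|[c c0 Hc]]; [|split=> //]; exists c => //;
  move: Hc; rewrite inv_transv.
Qed.

(** The set is the product H V, a group because V lies in [SL] and normalizes [H]: [A B w^-1 v^-1 =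
    (A v^-1) (v (B w^-1) v^-1)]. *)
Lemma subgroup_mod_transv i : is_subgroup (mod_transv i).
Proof.
have [_ H1 HM _] := sgH.
split; first by move=> ? [].
- split; first exact: isGL1.
  by exists 0; rewrite ?mxE // oppr0 /transv mul0mx addr0 mulmx1.
- move=> A B HA HB; have GA := HA.1; have GB := HB.1.
  apply/mod_transvP; first exact: isGLM.
  have /mod_transvP [//|c c0 Hc] := HA; have /mod_transvP [//|c' c'0 Hc'] := HB.
  exists (c' + c); first by rewrite mxE c0 c'0 addr0.
  have SLt := SL_transv_col c0; have SLt' := SL_transv_col c'0.
  have Gt := isGL_SL SLt; have Gt' := isGL_SL SLt'.
  rewrite addrC -transvDl // invM //.
  have := HM _ _ Hc (SL_invariantV SLt Hc').
  by rewrite !mulmxA mulmxVK.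
- move=> A B HA AB BA; have GA := HA.1; rewrite -(inv_uniq AB BA).
  apply/mod_transvP; first exact: isGL_inv.
  have /mod_transvP [//|c c0 Hc] := HA; have SLt := SL_transv_col c0.
  have Gt := isGL_SL SLt; have nc0 : (- c) i 0 = 0 by rewrite mxE c0 oppr0.
  exists (- c) => //; rewrite inv_transv // opprK.
  have := invH SLt (subgroup_inv sgH Hc).
  by rewrite invM ?invK ?mulmxA ?mul_invmx ?mul1mx //; apply: isGL_inv.
Qed.

(** A generator [x = xmx j k a] with [k = i] is in V. Otherwise some [h'] in [H] sends the line of
    ['e_i] to that of ['e_k], so [v = h' x h'^-1] is in V and [x v^-1 = h'^-1 (v h' v^-1)] is in
    [H]. *)
Lemma SL_mod_transv i A h : H h -> ~ central_GL h -> SL A -> mod_transv i A.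
Proof.
have [HG H1 HM _] := sgH.
move=> Hh nch SLA; apply: (SLA (mod_transv i)); first exact: subgroup_mod_transv.
move=> _ [j [k [a [jk ->]]]]; rewrite -/(xmx j k a).
have SLx := SL_xmx a jk; have Gx := isGL_SL SLx.
apply/mod_transvP => //.
have [ik|ik] := eqVneq i k.
  exists (a *: delta_mx j 0); first by rewrite !mxE ik eq_sym (negPf jk) mulr0.
  by rewrite ik -xmx_transv mulmx_inv.
have [h' [l [Hh' l0 h'e]]] := moves_basis_lines Hh nch ik.
have Gh := HG _ Hh'; have ul := divD l0.
(* The factor [l^-1] comes from ['e_k *m inv h' = l^-1 *: 'e_i] and stands to the right of [a]. *)
pose c := h' *m (\col_m ((a *: delta_mx j (0 : 'I_1) : 'cV[D]_n) m 0 * l^-1)).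
have c0 : c i 0 = 0.
  have -> : c i 0 = ('e_i *m c) 0 0 by rewrite -rowE [RHS]mxE.
  by rewrite mulmxA h'e -scalemxAl -rowE !mxE eq_sym (negPf jk) mulr0 mul0r mulr0.
have xE : xmx j k a = inv h' *m transv c 'e_i *m h'.
  rewrite mulmxDr mulmx1 mulmxDl mul_invmx // /c !mulmxA mul_invmx // mul1mx.
  rewrite -mulmxA h'e; congr (_ + _); apply/matrixP=> p q.
  rewrite !mxE big_ord1 !mxE /= andbT.
  by case: (p == j); case: (q == k); rewrite ?(mulr0,mul0r,mulr1,mulrVK).
have SLt := SL_transv_col c0.
exists c => //; rewrite xE -!mulmxA; apply: HM; first exact: subgroup_inv.
by rewrite mulmxA; apply: SL_invariantV.
Qed.

(* SL lies in H V with V abelian and normalizing H, so its commutators lie in H. *)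
Lemma SL_commutator_sub A B h : H h -> ~ central_GL h -> SL A -> SL B ->
  H (A *m B *m inv A *m inv B).
Proof.
have [HG H1 HM _] := sgH.
move=> Hh nch SLA SLB; have i := Ordinal n_gt1.
have GA := isGL_SL SLA; have GB := isGL_SL SLB.
have /mod_transvP [//|c c0] := SL_mod_transv i Hh nch SLA.
have /mod_transvP [//|c' c'0] := SL_mod_transv i Hh nch SLB.
have SLv := SL_transv_col c0; have SLw := SL_transv_col c'0.
have vwC : transv c 'e_i *m transv c' 'e_i = transv c' 'e_i *m transv c 'e_i.
  by rewrite !transvDl // addrC.
move: SLv SLw vwC; set v := transv c _; set w := transv c' _ => SLv SLw vwC.
have Gv := isGL_SL SLv; have Gw := isGL_SL SLw.
set a := A *m inv v; set b := B *m inv w => Ha Hb.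
have Ga := HG _ Ha; have Gb := HG _ Hb.
have [-> ->] : A = a *m v /\ B = b *m w by rewrite !mulmxVK.
clearbody a b v w.
(* As [v] and [w] commute, the commutator is a product of elements of [H] and of their conjugates by
   [v] and [w]. *)
have -> : a *m v *m (b *m w) *m inv (a *m v) *m inv (b *m w) =
    a *m (v *m b *m inv v) *m (w *m inv a *m inv w) *m inv b.
  have wvC : w *m inv v = inv v *m w.
    by rewrite -[RHS](mulmxK _ Gv) -(mulmxA _ w) -vwC mulmxA mul_invmx ?mul1mx.
  by rewrite !invM // !mulmxA -(mulmxA _ w (inv v)) wvC !mulmxA.
apply: (HM); last exact: subgroup_inv.
apply: (HM); last by apply: SL_invariantV => //; apply: subgroup_inv.
by apply: HM => //; apply: SL_invariantV.
Qed.

(** This is the commutator of [dmx i d] with a Weyl element, and [SL] is normal. *)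
Lemma SL_dmx_dmxV i j d : i != j -> d != 0 -> SL (dmx i d *m dmx j d^-1).
Proof.
have [_ _ SLM _] := subgroupSL D n.
move=> ij d0; have ud := divD d0; have Gd := isGL_dmx i ud.
have ji : j != i by rewrite eq_sym.
have SLw := @SL_wmx D n j i ji; have Gw := isGL_SL SLw.
have -> : dmx i d *m dmx j d^-1 = dmx i d *m wmx D j i *m inv (dmx i d) *m inv (wmx D j i).
  by rewrite inv_dmx // -(mulmxA _ (wmx D j i)) -dmx_wmx // mulmxA mulmxK.
by apply: SLM; [exact: SL_normalV | exact: subgroup_inv (subgroupSL D n) SLw].
Qed.

(* x_ij(a) is a commutator: for d commuting with a and d^2 != 1, put b = (d^2 - 1)^-1 a;
   then [diag(d, d^-1), x_ij(b)] = x_ij(d b d - b) = x_ij(a). *)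
Lemma SL_sub_invariant h A : infinite_ring D -> H h -> ~ central_GL h -> SL A -> H A.
Proof.
move=> infD Hh nch SLA; apply: (SLA H); first exact: sgH.
move=> _ [i [j [a [ij ->]]]]; rewrite -/(xmx i j a).
have [->|a0] := eqVneq a 0; first by rewrite /xmx scale0r addr0; case: sgH.
(* The choice [d = a] works unless [a] is 1 or -1; those commute with everything, and an infinite
   [D] offers some [d] outside 0, 1, -1. *)
have [d [d0 d1 d2 da]] : exists d, [/\ d != 0, d != 1, d != -1 & d * a = a * d].
  have [->|a1] := eqVneq a 1.
    have [d] := infD [:: 0; 1; -1]; rewrite !inE !negb_or => /and3P[*].
    by exists d; rewrite mulr1 mul1r.
  have [->|a2] := eqVneq a (-1); last by exists a.
  have [d] := infD [:: 0; 1; -1]; rewrite !inE !negb_or => /and3P[*].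
  by exists d; rewrite mulrN1 mulN1r.
have uq : d * d - 1 \is a GRing.unit.
  have -> : d * d - 1 = (d - 1) * (d + 1).
    by rewrite mulrDr mulr1 mulrBl mul1r addrA subrK.
  by rewrite unitrMl; apply: divD; rewrite ?subr_eq0 ?addr_eq0.
pose b := (d * d - 1)^-1 * a.
have dq : d * (d * d - 1)^-1 = (d * d - 1)^-1 * d.
  by apply: commrV; rewrite /GRing.comm mulrBr mulrBl mulr1 mul1r mulrA.
have bE : d * b * d - b = a.
  by rewrite /b mulrA dq -!mulrA -da (mulrA d) -{2}[a]mul1r -mulrBr -mulrBl mulKr.
have SLt := SL_dmx_dmxV ij d0; have SLx := SL_xmx b ij.
have := SL_commutator_sub Hh nch SLt SLx.
have -> : dmx i d *m dmx j d^-1 *m xmx i j b = xmx i j (d * b * d) *m (dmx i d *m dmx j d^-1).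
  have ud := divD d0; rewrite -mulmxA dmx_xmx ?unitrV // eqxx invrK mulmxA.
  by rewrite dmx_xmx // !eqxx [j == i]eq_sym (negPf ij) mul1r mulr1 mulrA mulmxA.
by rewrite mulmxK ?inv_xmx ?xmxD ?bE //; apply: isGL_SL.
Qed.

End Invariant.


(** It fails to commute with [xmx j i 1]: the [(i, i)] entries of the two products are [1 + a] and
    1. *)
Lemma xmx_noncentral i j a : i != j -> a != 0 -> ~ central_GL (xmx i j a).
Proof.
move=> ij a0 [_ /(_ (xmx j i 1))]; have ji : j != i by rewrite eq_sym.
move=> /(_ (isGL_SL (SL_xmx _ ji))) /(congr1 (mulmx 'e_i)).
rewrite !mulmxA [in RHS]rowB_xmx (negPf ij) !rowB_xmx eqxx mulmxDl -scalemxAl !rowB_xmx.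
rewrite eqxx (negPf ij) scale1r scalerDr addrA => /rowP /(_ i) /eqP.
rewrite !mxE !eqxx (negPf ij) /= mulr0 addr0 mulr1 -subr_eq0 addrAC subrr add0r.
by rewrite (negPf a0).
Qed.

(** * Subgroups of finite index *)

Hypothesis infD : infinite_ring D.

Lemma infinite_pigeonhole (T : finType) (F : D -> T) :
  exists a b, a != b /\ F a = F b.
Proof.
have uniq_size m : exists s : seq D, uniq s /\ size s = m.
  elim: m => [|m [s [us <-]]]; first by exists [::].
  by have [x xs] := infD s; exists (x :: s); rewrite /= xs.
have [s [us ss]] := uniq_size #|T|.+1.
apply: NNPP => nF; have injF : injective F.
  by move=> a b Fab; apply/eqP; apply: contraT => ab; case: nF; exists a, b.
have := max_card (mem (map F s)).
by rewrite (card_uniqP _) ?map_inj_uniq // size_map ss ltnn.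
Qed.

Lemma SL_sub_finite_index (H K : 'M[D]_n -> Prop) :
  is_subgroup K -> subgroup_of H K -> finite_index H K ->
  (forall A, SL A -> K A) -> forall A, SL A -> H A.
Proof.
move=> sgK [sgH HK] [s [sK Ks]] SLK.
have [HG H1 HM _] := sgH; have [KG _ KM _] := sgK.
have [_ SL1 SLM _] := subgroupSL D n.
(* The SL-core of [H], the intersection of its conjugates under [SL]; it suffices to find a
   non-central element in it. *)
pose C A := isGL A /\ forall e, SL e -> H (inv e *m A *m e).
have sgC : is_subgroup C.
  have sge e : SL e -> is_subgroup (fun A => H (inv e *m A *m e)).
    by move=> SLe; apply: subgroup_conj => //; apply: isGL_SL.
  split; first by move=> ? [].
  - by split=> [|e /sge[]]; first exact: isGL1.
  - move=> A B [GA HA] [GB HB]; split=> [|e SLe]; first exact: isGLM.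
    by case: (sge e SLe) => _ _ eM _; apply: eM; auto.
  - move=> A B [GA HA] AB BA; split=> [|e SLe]; first by exists A.
    by case: (sge e SLe) => _ _ _ eV; apply: (eV A); auto.
have invC : SL_invariant C.
  move=> g A SLg [GA HA]; have Gg := isGL_SL SLg.
  split=> [|e SLe]; first by apply: isGLM => //; apply: isGLM => //; apply: isGL_inv.
  have := HA (g *m e) (SLM _ _ SLg SLe).
  by rewrite invM ?mulmxA //; apply: isGL_SL.
suff [c Cc nc] : exists2 c, C c & ~ central_GL c.
  move=> A SLA; have := (SL_sub_invariant sgC invC infD Cc nc SLA).2 _ SL1.
  by rewrite mulmx1 (inv_uniq (mulmx1 _) (mulmx1 _)) mul1mx.
pose i := Ordinal n_gt1; have [j ij] := ex_neq i.
pose coset A t := t \in s /\ exists h, H h /\ A = t *m h.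
pose r A := epsilon (inhabits 0) (coset A).
have rP A : K A -> coset A (r A).
  by move=> /Ks[t ts HA]; apply: (epsilon_spec (inhabits 0) (coset A)); exists t.
(* To each scalar corresponds the tuple of coset representatives of [t^-1 xmx i j a t], for [t] in
   [s], coded by positions in [s]. There are finitely many codes, so two scalars share one. *)
have [a [b [ab Fab]]] := infinite_pigeonhole (fun a => [ffun p : 'I_(size s) =>
  inord (index (r (inv (nth 0 s p) *m xmx i j a *m nth 0 s p)) s) : 'I_(size s).+1]).
have Kc t d : t \in s -> K (inv t *m xmx i j d *m t).
  move=> /sK Kt; apply: (KM) => //; apply: (KM); first exact: subgroup_inv.
  by apply: SLK; apply: SL_xmx.
have rE t : t \in s -> r (inv t *m xmx i j a *m t) = r (inv t *m xmx i j b *m t).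
  move=> ts; have [ras _] := rP _ (Kc t a ts); have [rbs _] := rP _ (Kc t b ts).
  have ps : (index t s < size s)%N by rewrite index_mem.
  move/ffunP/(_ (Ordinal ps)): Fab; rewrite !ffunE /= nth_index //.
  move/(congr1 val); rewrite /= !inordK ?ltnS ?index_size // => E.
  by rewrite -[LHS](nth_index 0 ras) E nth_index.
have Ga := isGL_SL (SL_xmx a ij); have Gb := isGL_SL (SL_xmx b ij).
exists (xmx i j (- b + a)); last by apply: xmx_noncentral; rewrite // addrC subr_eq0.
split=> [|e SLe]; first exact: isGL_SL (SL_xmx _ ij).
have [t ts [h0 [Hh0 eE]]] := Ks e (SLK e SLe).
have [_ [h1 [Hh1]]] := rP _ (Kc t a ts); have [_ [h2 [Hh2]]] := rP _ (Kc t b ts).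
have Kr : K (r (inv t *m xmx i j b *m t)) by apply: sK; case: (rP _ (Kc t b ts)).
rewrite -rE //; move: Kr; rewrite -rE //; set q := r _ => Kq bE aE.
have Gq := KG _ Kq; have Gt := KG _ (sK _ ts).
have [G0 [G1 G2]] := (HG _ Hh0, (HG _ Hh1, HG _ Hh2)).
(* With [e = t h0], the conjugates by [t] of [xmx i j a] and [xmx i j b] are [q h1] and [q h2] in
   one coset, so [q] cancels. *)
have -> : inv e *m xmx i j (- b + a) *m e = inv h0 *m (inv h2 *m h1) *m h0.
  rewrite eE -xmxD // -inv_xmx // invM // !mulmxA; congr (_ *m h0).
  rewrite -(mulmxA (inv h0)) -!mulmxA; congr (_ *m _).
  have -> : inv h2 *m h1 = inv (q *m h2) *m (q *m h1).
    by rewrite invM // !mulmxA mulmxVK.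
  rewrite -aE -bE !invM ?invK ?mulmxA ?mulmxK //; do ?apply: isGLM => //; exact: isGL_inv.
by do ?apply: (HM) => //; apply: subgroup_inv.
Qed.

(** * Almost subnormal chains and the equivalence *)

Lemma SL_sub_normal_in (H K : 'M[D]_n -> Prop) :
  is_subgroup H -> ~ (forall A, H A -> central_GL A) -> normal_in H K ->
  (forall A, SL A -> K A) -> forall A, SL A -> H A.
Proof.
move=> sgH nc nHK SLK A.
have [h nh] := not_all_ex_not _ _ nc; have [Hh nch] := imply_to_and _ _ nh.
apply: SL_sub_invariant Hh nch => // g x /[dup] /isGL_SL Gg /SLK Kg Hx.
by apply: (nHK g (inv g)) => //; rewrite ?mulmx_inv ?mul_invmx.
Qed.

Lemma SL_sub_almost_subnormal (N : 'M[D]_n -> Prop) :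
  ~ (forall A, N A -> central_GL A) -> almost_subnormal N (@isGL D n) ->
  forall A, SL A -> N A.
Proof.
move=> ncN [r [f [f0 fr fS]]].
(* Climbing from the bottom shows that each member contains [N], hence is non-central. *)
have chain m : (m <= r)%N -> forall A, N A -> f (r - m)%N A.
  elim: m => [|m IHm] mr A NA; first by rewrite subn0; apply/fr.
  have rm : (r - m.+1 < r)%N by rewrite ltn_subrL (leq_ltn_trans _ mr).
  have [[_ sub] _] := fS _ rm; apply: sub; rewrite subnSK //.
  by apply: IHm => //; apply: ltnW.
have ncf m : (m <= r)%N -> ~ (forall A, f m A -> central_GL A).
  move=> mr cf; apply: ncN => A NA; apply: cf.
  by rewrite -(subKn mr); apply: chain => //; apply: leq_subr.
(* Descent from GL. The subgroup property is carried along because the finite index step needs it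
   for the upper group. *)
suff SLf m : (m <= r)%N -> is_subgroup (f m) /\ forall A, SL A -> f m A.
  by move=> A SLA; apply/fr; apply: (SLf r _).2.
elim: m => [|m IHm] mr.
  split=> [|A /isGL_SL /f0 //].
  have [GG G1 GM GV] := subgroupGL D n; split.
  - by move=> A /f0.
  - exact/f0.
  - by move=> A B /f0 GA /f0 GB; apply/f0/GM.
  - by move=> A B /f0 GA AB BA; apply/f0/(GV A).
have [sgm SLm] := IHm (ltnW mr); have [sfm nf] := fS m mr.
split; first exact: sfm.1.
case: nf => [nf|ff]; last exact: SL_sub_finite_index ff SLm.
exact: SL_sub_normal_in sfm.1 (ncf _ mr) nf SLm.
Qed.

End DivisionRing.

Lemma subnormal_of_normal_in (R : unitRingType) n (N : 'M[R]_n -> Prop) :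
  subgroup_of N (@isGL R n) -> normal_in N (@isGL R n) -> subnormal N (@isGL R n).
Proof.
move=> sN nN; exists 1%N, (fun m => if m == 0%N then @isGL R n else N).
by split=> // -[].
Qed.

Lemma almost_subnormal_of_subnormal (R : unitRingType) n (H K : 'M[R]_n -> Prop) :
  subnormal H K -> almost_subnormal H K.
Proof.
move=> [r [f [f0 fr fS]]]; exists r, f; split=> // i /fS[sf nf].
by split=> //; left.
Qed.

Theorem theorem3p3 (D : unitRingType) (n : nat) (N : 'M[D]_n -> Prop) :
  division_ring_ax D -> infinite_ring D -> (2 <= n)%N ->
  subgroup_of N (@isGL D n) ->
  ~ (forall A, N A -> central_GL A) ->
  (almost_subnormal N (@isGL D n) <-> subnormal N (@isGL D n)) /\
  (subnormal N (@isGL D n) <-> normal_in N (@isGL D n)) /\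
  (normal_in N (@isGL D n) <-> (forall A, SL A -> N A)).
Proof.
move=> divD infD n_gt1 sN ncN.
(* The cycle runs: almost subnormal, contains [SL], normal, subnormal, almost subnormal. *)
have as_SL := SL_sub_almost_subnormal divD n_gt1 infD ncN.
have SL_n := normal_of_SL_sub divD n_gt1 sN.
have n_s := subnormal_of_normal_in sN.
have s_as := @almost_subnormal_of_subnormal D n N (@isGL D n).
by split; [split; auto | split; split; auto].
Qed.
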